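(* Let $n\ge 1$ and $0\le k\le n-1$, and let $$\theta_{n,k}=(k+1)\,k\,(k-1)\cdots 3\,2\,1\,(k+2)\,(k+3)\cdots n\in S_n.$$ Then $$|s^{-1}(\theta_{n,k})|=\frac{2k+2}{n+1}\binom{2n-2k-1}{n}.$$ Furthermore, for every integer $m\ge 0$, the number of permutations in $s^{-1}(\theta_{n,k})$ with exactly $m$ descents is $$N_k(n-k,m-k+1).$$
   Context: $S_n$ is the set of permutations of $\{1,\ldots,n\}$, written as words. The permutation $\theta_{n,k}$ consists of the decreasing word $(k+1)k\cdots 1$ followed by the increasing word $(k+2)(k+3)\cdots n$. The stack-sorting map $s$ is defined recursively on words of distinct positive integers: $s$ sends the empty word to itself, and if $\pi=LNR$ where $N$ is the largest entry of $\pi$, then $s(\pi)=s(L)s(R)N$. Thus $s$ maps $S_n$ to $S_n$. A descent of $\pi\in S_n$ is an index $i\in\{1,\ldots,n-1\}$ with $\pi_i>\pi_{i+1}$. The generalized Narayana numbers are $N_k(n,r)=\frac{k+1}{n}\binom{n}{r+k}\binom{n}{r-1}$. Binomial coefficients $\binom ab$ are $0$ unless $0\le b\le a$. *)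

(* Defs.v *)
From HB Require Import structures.
From mathcomp Require Import all_boot all_order all_algebra all_fingroup.
Set Implicit Arguments.
Unset Strict Implicit.
Unset Printing Implicit Defensive.
Import GRing.Theory.

(* Structural recursion on a fuel parameter that bounds the length of the
   word; [stack_sort0] and [stack_sort_cat] below are the recursion
   s(empty) = empty, s(L N R) = s(L) s(R) N. *)
Fixpoint stack_sort_rec (fuel : nat) (w : seq nat) : seq nat :=
  if fuel is f.+1 then
    if w is [::] then [::] else
    let N := foldr maxn 0 w in
    let i := index N w in
    stack_sort_rec f (take i w) ++ stack_sort_rec f (drop i.+1 w) ++ [:: N]
  else [::].

Definition stack_sort (w : seq nat) : seq nat := stack_sort_rec (size w) w.

(* The word p(1) ... p(n); 'S_n acts on {0, ..., n-1}, hence the shift. *)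
Definition word (n : nat) (p : 'S_n) : seq nat :=
  [seq (val (p i)).+1 | i <- enum 'I_n].

Definition stack_sort_fiber (n : nat) (w : seq nat) : {set 'S_n} :=
  [set p : 'S_n | stack_sort (word p) == w].

(* Descents are indexed here from 0 instead of from 1. *)
Definition descents (w : seq nat) : nat :=
  count (fun i => nth 0 w i > nth 0 w i.+1) (iota 0 (size w).-1).

Definition theta (n k : nat) : seq nat :=
  rev (iota 1 k.+1) ++ iota k.+2 (n - k.+1).

(* The binomial coefficient with an integer lower index, which vanishes when
   that index is negative (Negz). *)
Definition binz (a : nat) (b : int) : nat :=
  if b is Posz j then 'C(a, j) else 0.

Definition narayana (k n : nat) (r : int) : rat :=
  (k.+1%:R / n%:R * (binz n (r + k%:Z))%:R * (binz n (r - 1))%:R)%R.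

Lemma stack_sort0 : stack_sort [::] = [::].
Proof. by []. Qed.

Lemma stack_sort_rec_fuel f w :
  size w <= f -> stack_sort_rec f w = stack_sort w.
Proof.
rewrite /stack_sort.
have H g h v : size v <= g -> size v <= h ->
    stack_sort_rec g v = stack_sort_rec h v.
  elim: g h v => [|g IH] [|h] [|x v] //= le_g le_h.
  set N := maxn _ _; set i := (X in take X _).
  have i_le : i <= size v.
    have: N \in x :: v.
      rewrite /N; elim: (v) (x) => [|y u IHu] z /=; first by rewrite maxn0 inE.
      rewrite /maxn; case: ifP => _; last by rewrite inE eqxx.
      by rewrite inE IHu orbT.
    by rewrite -index_mem.
  have sz_take : size (take i (x :: v)) <= size v.
    by rewrite size_takel //= leqW.
  have sz_drop : size (drop i v) <= size v by rewrite size_drop leq_subr.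
  congr (_ ++ (_ ++ _)); apply: IH.
  - exact: leq_trans sz_take le_g.
  - exact: leq_trans sz_take le_h.
  - exact: leq_trans sz_drop le_g.
  - exact: leq_trans sz_drop le_h.
by move=> le_f; apply: H.
Qed.

Lemma stack_sort_cat (L R : seq nat) (N : nat) :
  (forall x, x \in L ++ R -> x < N) ->
  stack_sort (L ++ N :: R) = stack_sort L ++ stack_sort R ++ [:: N].
Proof.
move=> ltN.
have maxE : foldr maxn 0 (L ++ N :: R) = N.
  elim: L ltN => [|x L IH] ltN /=.
    apply/maxn_idPl; elim: R ltN => //= y R IH ltN.
    rewrite geq_max ltnW ?ltN ?mem_head //=; apply: IH => x xR.
    by apply: ltN; rewrite inE xR orbT.
  rewrite IH; first by apply/maxn_idPr; rewrite ltnW // ltN // mem_head.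
  by move=> y yLR; apply: ltN; rewrite inE yLR orbT.
have NL : N \notin L.
  by apply/negP=> NL; have := ltN N; rewrite mem_cat NL ltnn => /(_ isT).
have idx : index N (L ++ N :: R) = size L.
  by rewrite index_cat (negPf NL) /= eqxx addn0.
rewrite -(@stack_sort_rec_fuel (size (L ++ R)).+1); last first.
  by rewrite !size_cat /= addnS.
rewrite [stack_sort_rec _ _]/=.
case E: (L ++ N :: R) => [|x u]; first by case: (L) E.
rewrite -E maxE idx take_size_cat // -(cat_rcons N L R) drop_size_cat ?size_rcons //.
by rewrite !stack_sort_rec_fuel // size_cat ?leq_addl ?leq_addr.
Qed.

Lemma theta_perm (n k : nat) : k < n -> perm_eq (theta n k) (iota 1 n).
Proof.
move=> ltkn; rewrite /theta -[in iota 1 n](subnKC ltkn) iotaD.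
by rewrite perm_cat2r perm_rev.
Qed.

(* Main.v *)
(* Let F_k be the generating function of the preimages of theta_{n,k}, over all
   n, with x marking n and y marking descents.  Splitting a preimage L N R at
   its largest entry N splits theta_{n,k} without its last entry as s(L) s(R).
   A decreasing word of length at least 2 has no preimage, so s(L) is empty,
   the single entry k+1, or a prefix containing the initial decreasing run:
     F_0 = x (1 + F_0) (1 + y F_0),
     F_k = x y F_k + x^2 y F_{k-1} + x F_k (1 + y F_0)   for k >= 1.
   This gives F_k = (x y)^k F_0^{k+1}.  The coefficients of the powers of F_0
   come from the linear recurrence
   F_0^{p+1} = x (F_0^p + (1 + y) F_0^{p+1} + y F_0^{p+2}), which also yields
   the convolution identities, so that no inversion of series is needed. *)
Require Import Defs.
From mathcomp Require Import all_boot all_order all_algebra all_fingroup.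
From mathcomp Require Import ring zify.
Set Implicit Arguments.
Unset Strict Implicit.
Unset Printing Implicit Defensive.
Import GRing.Theory Num.Theory.

(** * Splitting at the largest letter and lists of preimages *)

Lemma uniq_split_max (u : seq nat) : u != [::] -> uniq u ->
  exists L N R, u = L ++ N :: R /\ forall x, x \in L ++ R -> x < N.
Proof.
elim: u => // y u IHu _ /= /andP[yNu uniq_u].
have [->|u_neq0] := eqVneq u [::]; first by exists [::], y, [::].
have [L [N [R [uE ltN]]]] := IHu u_neq0 uniq_u.
have [ltyN|leNy] := ltnP y N.
  exists (y :: L), N, R; split=> [|x]; first by rewrite uE.
  by rewrite inE => /predU1P[->|/ltN].
exists [::], y, u; split=> //= x xu.
have nyx : x != y by apply: contraNneq yNu => <-.
rewrite ltn_neqAle nyx (leq_trans _ leNy) //.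
by move: xu; rewrite uE mem_cat inE orbCA -mem_cat => /predU1P[->|/ltN/ltnW].
Qed.

Lemma perm_stack_sort (u : seq nat) : uniq u -> perm_eq (stack_sort u) u.
Proof.
have [n] := ubnP (size u); elim: n u => // n IHn u le_un uniq_u.
have [->|u_neq0] := eqVneq u [::]; first by [].
have [L [N [R [uE ltN]]]] := uniq_split_max u_neq0 uniq_u.
move: le_un uniq_u; rewrite uE size_cat /= addnS ltnS cat_uniq => le_LR.
case/and3P=> uniq_L _ /andP[_ uniq_R]; rewrite stack_sort_cat //.
apply: perm_cat; first by apply: IHn => //; lia.
rewrite cats1 perm_rcons perm_cons; apply: IHn => //; lia.
Qed.

(** Searching only among rearrangements of [w] makes the list finite and misses no duplicate-free
    preimage, by [perm_stack_sort]. *)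
Definition preims (w : seq nat) : seq (seq nat) :=
  [seq u <- permutations w | stack_sort u == w].

Lemma uniq_preims w : uniq (preims w).
Proof. by rewrite filter_uniq ?permutations_uniq. Qed.

Lemma mem_preims w u : uniq w ->
  (u \in preims w) = uniq u && (stack_sort u == w).
Proof.
move=> uniq_w; rewrite mem_filter mem_permutations andbC.
apply/andP/andP=> -[]; first by move=> /perm_uniq->.
by move=> uniq_u /eqP<-; rewrite perm_sym perm_stack_sort.
Qed.

Lemma perm_preims w u : u \in preims w -> perm_eq u w.
Proof. by rewrite mem_filter mem_permutations => /andP[]. Qed.

(** By [stack_sort_cat], a preimage [L ++ N :: R] amounts to a cut of [v] at the length of [L] and
    one preimage of each piece. *)
Lemma preims_rcons v N : uniq v -> (forall x, x \in v -> x < N) ->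
  perm_eq (preims (rcons v N))
    [seq LR.1 ++ N :: LR.2 | i <- iota 0 (size v).+1,
       LR <- [seq (L, R) | L <- preims (take i v), R <- preims (drop i v)]].
Proof.
move=> uniq_v ltN.
have NNv : N \notin v by apply/negP=> /ltN; rewrite ltnn.
have uniq_vN : uniq (rcons v N) by rewrite rcons_uniq NNv.
have memP (i : nat) LR :
    LR \in [seq (L, R) | L <- preims (take i v), R <- preims (drop i v)] ->
  [/\ LR.1 \in preims (take i v) & LR.2 \in preims (drop i v)].
  by case/allpairsP=> -[L R] /= [LP RP ->].
apply: uniq_perm; first exact: uniq_preims.
  apply: allpairs_uniq_dep => [||].
  - exact: iota_uniq.
  - move=> i _; apply: allpairs_uniq; try exact: uniq_preims.
    by move=> [? ?] [? ?] _ _ [-> ->].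
  pose LT : eqType := (seq nat * seq nat)%type.
  have tagP := @allpairsPdep nat (fun=> LT) _ (existT (fun=> LT)).
  move=> p q pP qP; move: (elimT (tagP _ _ _) pP) (elimT (tagP _ _ _) qP).
  move=> [i [[L R] [i_le /memP[Lp Rp] ->]]].
  move=> [j [[L' R'] [j_le /memP[L'p R'p] ->]]] E.
  rewrite /= in E Lp Rp L'p R'p.
  have NL (S : seq nat) l : S \in preims (take l v) -> N \notin S.
    move=> /perm_preims/perm_mem->; apply: contra NNv; exact: mem_take.
  (* [N] occurs in neither left part, so its position in the common word recovers their lengths, and
     hence the cut. *)
  have szL : size L = size L'.
    have := congr1 (index N) E; rewrite !index_cat.
    by rewrite (negPf (NL _ _ Lp)) (negPf (NL _ _ L'p)) /= eqxx !addn0.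
  move/eqP: E; rewrite eqseq_cat // eqseq_cons eqxx => /andP[/eqP-> /eqP->].
  suff -> : i = j by [].
  move: i_le j_le; rewrite !mem_iota !add0n !ltnS => i_le j_le.
  by rewrite -(size_takel i_le) -(size_takel j_le)
    -(perm_size (perm_preims Lp)) -(perm_size (perm_preims L'p)).
move=> u; rewrite mem_preims //; apply/andP/allpairsPdep.
  move=> [uniq_u /eqP su].
  have u_neq0 : u != [::] by case: (u) su; case: (v).
  have [L [M [R [uE ltM]]]] := uniq_split_max u_neq0 uniq_u.
  move: su uniq_u; rewrite uE stack_sort_cat // catA cats1 => /rcons_inj[vE ->].
  rewrite cat_uniq => /and3P[uniq_L _ /andP[_ uniq_R]].
  exists (size (stack_sort L)), (L, R); split=> //.
    by rewrite mem_iota /= -vE size_cat ltnS leq_addr.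
  rewrite -vE take_size_cat // drop_size_cat //.
  apply: allpairs_f; rewrite mem_filter eqxx mem_permutations perm_sym /=;
    exact: perm_stack_sort.
move=> [i [[L R] [_ /memP[/= Lp Rp] ->]]].
have permLR : perm_eq (L ++ R) v.
  by rewrite -(cat_take_drop i v) perm_cat ?perm_preims.
have ltNLR x : x \in L ++ R -> x < N by rewrite (perm_mem permLR) => /ltN.
split; last first.
  move: Lp Rp; rewrite !mem_filter stack_sort_cat // => /andP[/eqP-> _].
  by move=> /andP[/eqP-> _]; rewrite catA cat_take_drop cats1.
have /perm_uniq-> // : perm_eq (L ++ N :: R) (rcons v N).
by rewrite -cat1s perm_catCA cat1s perm_sym perm_rcons perm_cons perm_sym.
Qed.

(** * Descents around the largest letter *)

Lemma descents_cons2 x y w :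
  descents [:: x, y & w] = (y < x) + descents (y :: w).
Proof.
rewrite /descents /= -[1]addn0 iotaDl count_map.
by congr (_ + _).
Qed.

(** The step into [N] is an ascent; the step out of [N], if there is one, is a descent. *)
Lemma descents_max L N R : (forall x, x \in L ++ R -> x < N) ->
  descents (L ++ N :: R) = descents L + descents R + (R != [::]).
Proof.
elim: L => [|x L IHL] ltN.
  case: R ltN => [|y R] ltN //=.
  by rewrite descents_cons2 ltN ?mem_head // addnC.
have ltN' y : y \in L ++ R -> y < N.
  by move=> yLR; apply: ltN; rewrite inE yLR orbT.
have ltxN : x < N by apply: ltN; rewrite mem_head.
case: L IHL {ltN} ltN' => [|y L] IHL ltN' /=; rewrite !descents_cons2 IHL //.
  by rewrite ltnNge (ltnW ltxN).
by rewrite !addnA.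
Qed.

(** * From permutations to words *)

Lemma word_inj n : injective (@word n).
Proof.
move=> p q /eq_in_map pq; apply/permP => i; apply/val_inj/succn_inj.
by apply: pq; rewrite mem_enum.
Qed.

Lemma perm_word n (p : 'S_n) : perm_eq (word p) (iota 1 n).
Proof.
apply: uniq_perm; rewrite ?iota_uniq //.
  rewrite map_inj_uniq ?enum_uniq // => i j [] /val_inj; exact: perm_inj.
move=> x; rewrite mem_iota; apply/mapP/idP=> [[i _ ->]|]; first exact: ltn_ord.
case: x => // x; rewrite add1n ltnS /= => ltxn; have ltxn' : (x < n)%N := ltxn.
by exists (p^-1 (Ordinal ltxn'))%g; rewrite ?mem_enum // permKV.
Qed.

Lemma word_surj n u : perm_eq u (iota 1 n) -> exists p : 'S_n, word p = u.
Proof.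
move=> perm_u.
have sz_u : size u = n by rewrite (perm_size perm_u) size_iota.
have uniq_u : uniq u by rewrite (perm_uniq perm_u) iota_uniq.
have u_bd (i : 'I_n) : (0 < nth 0 u i <= n)%N.
  have := mem_nth 0 (s := u) (n := i).
  by rewrite sz_u ltn_ord (perm_mem perm_u) mem_iota add1n ltnS => /(_ isT).
have lt_u (i : 'I_n) : ((nth 0 u i).-1 < n)%N by have := u_bd i; lia.
have inj_f : injective (fun i : 'I_n => Ordinal (lt_u i)).
  move=> i j [] /= E; apply/val_inj/eqP.
  rewrite -(nth_uniq 0 _ _ uniq_u) ?sz_u ?ltn_ord //; apply/eqP.
  by rewrite /= -(prednK (proj1 (andP (u_bd i)))) E prednK //; case/andP: (u_bd j).
exists (perm inj_f); apply: (@eq_from_nth _ 0) => [|i].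
  by rewrite size_map size_enum_ord.
rewrite size_map size_enum_ord => ltin.
rewrite (nth_map (Ordinal ltin)) ?size_enum_ord // permE /= nth_enum_ord //.
by rewrite prednK //; case/andP: (u_bd (Ordinal ltin)).
Qed.

Lemma card_fiber n w (P : pred (seq nat)) : perm_eq w (iota 1 n) ->
  #|[set p in stack_sort_fiber n w | P (word p)]| = count P (preims w).
Proof.
move=> perm_w; rewrite cardE -(size_map (@word n)) -size_filter.
apply/perm_size/uniq_perm.
- by rewrite map_inj_uniq ?enum_uniq //; exact: word_inj.
- by rewrite filter_uniq ?uniq_preims.
move=> u; rewrite mem_filter; apply/mapP/andP.
  move=> [p]; rewrite mem_enum !inE => /andP[/eqP sp Pp] ->.
  rewrite Pp mem_filter sp eqxx mem_permutations; split=> //=.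
  by rewrite (permPl (perm_word p)) perm_sym.
move=> [Pu up]; have perm_u := perm_preims up.
have [p pE] : exists p : 'S_n, word p = u.
  by apply: word_surj; rewrite (permPl perm_u).
exists p => //; rewrite mem_enum !inE pE Pu andbT.
by move: up; rewrite mem_filter => /andP[].
Qed.

(** * Coefficients of the powers of F_0 *)

Section DescentSeries.
Local Open Scope ring_scope.

(* [cpow p N] is the coefficient of x^N in F_0^p, a polynomial in y = 'X. *)
Fixpoint cpow (p N : nat) : {poly rat} :=
  match N, p with
  | 0, 0 => 1
  | 0, _.+1 => 0
  | _.+1, 0 => 0
  | N'.+1, p'.+1 =>
      cpow p' N' + (1 + 'X) * cpow p'.+1 N' + 'X * cpow p'.+2 N'
  end.

Arguments cpow : simpl never.

Lemma cpow0 N : cpow 0 N = (N == 0)%:R.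
Proof. by case: N. Qed.

Lemma cpowS0 p : cpow p.+1 0 = 0.
Proof. by []. Qed.

Lemma cpowSS p N : cpow p.+1 N.+1 =
  cpow p N + (1 + 'X) * cpow p.+1 N + 'X * cpow p.+2 N.
Proof. by []. Qed.

(** This is F_0^p * F_0 = F_0^{p+1}. The recurrence is linear with coefficients independent of [p],
    so applying it to the left factor reduces [N.+1] to [N] at [p], [p.+1] and [p.+2]. *)
Lemma cpow_conv p N :
  \sum_(0 <= i < N.+1) cpow p i * cpow 1 (N - i) = cpow p.+1 N.
Proof.
elim: N p => [|N IHN] [|p]; rewrite big_nat_recl //.
- by rewrite big_geq // addr0 mulr0.
- by rewrite big_geq // addr0 mulr0.
- by rewrite big1 ?addr0 ?mul1r // => i _; rewrite mul0r.
rewrite cpowS0 mul0r add0r.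
under eq_bigr => i _ do rewrite subSS cpowSS !mulrDl -!mulrA.
by rewrite !big_split /= -!mulr_sumr !IHN -mulrDl -cpowSS.
Qed.

Lemma natr_mul_bin_left N i :
  i.+1%:R * 'C(N, i.+1)%:R = (N%:R - i%:R) * 'C(N, i)%:R :> rat.
Proof.
have [leiN|ltNi] := leqP i N; last by rewrite !bin_small ?mulr0 // ltnW.
by rewrite -natrB // -!natrM mul_bin_left.
Qed.

(** The value predicted by Lagrange inversion for F_0 = x (1 + F_0) (1 + y F_0), verified here by
    induction through the recurrence. *)
Lemma cpow_coef p N j :
  N%:R * (cpow p N)`_j = p%:R * 'C(N, j)%:R * 'C(N, p + j)%:R.
Proof.
elim: N p j => [|N IHN] [|p] j; rewrite ?mul0r //.
- by rewrite bin0n mulr0.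
- by rewrite cpow0 coef0 mulr0.
rewrite cpowSS !coefD mulrDl mul1r coefD !coefXM.
(* The induction hypothesis only gives [N%:R] times a coefficient, so it says nothing at [N = 0]. *)
have [->|N_gt0] := posnP N.
  rewrite !cpowS0 !coef0 if_same !addr0 mul1r.
  case: p => [|p]; last by rewrite coef0 addSn (@bin_small _ (_ + _).+1) ?mulr0.
  by rewrite coef1; case: j => [|j] //=; rewrite (@bin_small _ (1 + j.+1)) ?mulr0.
have N_neq0 : N%:R != 0 :> rat by rewrite pnatr_eq0 -lt0n.
pose a' : rat := (if j is i.+1 then 'C(N, i) else 0)%:R.
have a'E q : N%:R * (if j == 0%N then 0 else (cpow q.+1 N)`_j.-1) =
    q.+1%:R * a' * 'C(N, q + j)%:R.
  by rewrite /a'; case: (j) => [|i] /=; rewrite ?mulr0 ?mul0r // IHN addSnnS.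
have bin_succ : 'C(N.+1, j)%:R = 'C(N, j)%:R + a'.
  by rewrite /a'; case: (j) => [|i]; rewrite ?bin0 ?addr0 // binS natrD.
have rel_a : j%:R * 'C(N, j)%:R = (N%:R - j%:R + 1) * a'.
  rewrite /a'; case: (j) => [|i]; first by rewrite mulr0 mul0r.
  by rewrite natr_mul_bin_left -natr1; ring.
have rel_b := natr_mul_bin_left N (p + j).
apply: (mulfI N_neq0).
rewrite [LHS]mulrCA !(mulrDr N%:R) !IHN !a'E bin_succ.
rewrite !addSn binS natrD.
move: rel_a rel_b; rewrite -!natr1 natrD.
set a := 'C(N, j)%:R; set b := 'C(N, p + j)%:R; set b' := 'C(N, _)%:R.
move=> rel_a rel_b.
apply/eqP; rewrite -subr_eq0; apply/eqP.
(* The difference of the two sides is a combination of [rel_a] and [rel_b], each relating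
   neighbouring binomials. *)
transitivity (- (b + b') * (j%:R * a - (N%:R - j%:R + 1) * a') +
   (a + a') * ((p%:R + j%:R + 1) * b' - (N%:R - (p%:R + j%:R)) * b)).
  ring.
by rewrite rel_a rel_b !subrr !mulr0 addr0.
Qed.

(** At y = 1 the equation becomes F_0 = x (1 + F_0)^2; the same induction applies, with row 2N of
    Pascal's triangle. *)
Lemma cpow_horner1 p N : N%:R * (cpow p N).[1] = p%:R * 'C(N.*2, p + N)%:R.
Proof.
elim: N p => [|N IHN] [|p]; rewrite ?mul0r //.
- by rewrite mulr0.
- by rewrite cpow0 horner0 mulr0.
rewrite cpowSS !hornerD !hornerM !hornerD !hornerC !hornerX mul1r.
have [->|N_gt0] := posnP N.
  rewrite !cpowS0 !horner0 !mulr0 !addr0 mul1r.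
  case: p => [|p]; first by rewrite cpow0 hornerC.
  by rewrite horner0 addSn addnS bin_small ?mulr0.
have N_neq0 : N%:R != 0 :> rat by rewrite pnatr_eq0 -lt0n.
apply: (mulfI N_neq0).
have -> : (N.+1.*2 = N.*2.+2)%N by [].
rewrite [LHS]mulrCA mulrDl mul1r !(mulrDr N%:R) !(mulrCA N%:R) ?mul1r !IHN.
rewrite addSn addnS !binS !natrD !addSn.
have := natr_mul_bin_left N.*2 (p + N).
have := natr_mul_bin_left N.*2 (p + N).+1.
rewrite -!natr1 natrD -muln2 natrM.
set c0 := 'C(_, p + N)%:R; set c1 := 'C(_, (p + N).+1)%:R; set c2 := 'C(_, _)%:R.
move=> rel2 rel1.
apply/eqP; rewrite -subr_eq0; apply/eqP.
transitivity (((p%:R + N%:R + 1 + 1) * c2 -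
    (N%:R * 2 - (p%:R + N%:R + 1)) * c1) +
  ((p%:R + N%:R + 1) * c1 - (N%:R * 2 - (p%:R + N%:R)) * c0)).
  ring.
by rewrite rel1 rel2; ring.
Qed.

(** * Descent polynomials of fibers *)

Definition des_gf (w : seq nat) : {poly rat} :=
  \sum_(u <- preims w) 'X^(descents u).

Lemma des_gf_nil : des_gf [::] = 1.
Proof. by rewrite /des_gf /preims /= big_seq1. Qed.

(** The last factor records the descent out of [N], which exists exactly when the right part is
    nonempty. *)
Lemma des_gf_rcons v N : uniq v -> (forall x, x \in v -> (x < N)%N) ->
  des_gf (rcons v N) = \sum_(0 <= i < (size v).+1)
    des_gf (take i v) * des_gf (drop i v) * (if (i < size v)%N then 'X else 1).
Proof.
move=> uniq_v ltN; rewrite /des_gf (perm_big _ (preims_rcons uniq_v ltN)).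
rewrite big_allpairs_dep /index_iota subn0.
apply: eq_big_seq => i _.
rewrite big_allpairs !mulr_suml big_seq [RHS]big_seq.
apply: eq_bigr => L Lp.
rewrite mulr_sumr mulr_suml big_seq [RHS]big_seq; apply: eq_bigr => R Rp.
rewrite descents_max => [|x].
  rewrite !exprD.
  suff -> : (R != [::]) = (i < size v)%N by case: ifP.
  rewrite -size_eq0 (perm_size (perm_preims Rp)) size_drop; lia.
have /perm_mem-> : perm_eq (L ++ R) (take i v ++ drop i v).
  by rewrite perm_cat ?perm_preims.
by rewrite cat_take_drop => /ltN.
Qed.

(** A nonempty image ends with its largest letter, so the fiber is empty. *)
Lemma des_gf_not_max v N x : x \in v -> (N < x)%N -> uniq v -> N \notin v ->
  des_gf (rcons v N) = 0.
Proof.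
move=> xv ltNx uniq_v NNv.
rewrite /des_gf big_seq big1 // => u.
rewrite mem_preims ?rcons_uniq ?NNv // => /andP[uniq_u /eqP su].
have u_neq0 : u != [::] by case: (u) su; case: (v).
have [L [M [R [uE ltM]]]] := uniq_split_max u_neq0 uniq_u.
have xu : x \in u.
  by rewrite -(perm_mem (perm_stack_sort uniq_u)) su mem_rcons inE xv orbT.
move: su; rewrite uE stack_sort_cat // catA cats1 => /rcons_inj[_ MN].
move: xu; rewrite uE mem_cat inE orbCA -mem_cat MN => /predU1P[xN|].
  by move: ltNx; rewrite xN ltnn.
by move=> /ltM; rewrite MN ltnNge (ltnW ltNx).
Qed.

Lemma sorted_ltn_uniq w : sorted ltn w -> uniq w.
Proof. exact: (sorted_uniq ltn_trans ltnn). Qed.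

Lemma sorted_rconsP v N : sorted ltn (rcons v N) ->
  sorted ltn v /\ forall x, x \in v -> (x < N)%N.
Proof.
rewrite -cats1 sorted_pairwise; last exact: ltn_trans.
rewrite pairwise_cat allrel1r => /and3P[/allP ltN srt_v _].
by split; [rewrite sorted_pairwise //; exact: ltn_trans|].
Qed.

Lemma cpow_conv0 p N :
  \sum_(0 <= i < N.+1) cpow p i * cpow 0 (N - i) = cpow p N.
Proof.
rewrite big_nat_recr //= subnn mulr1 big_nat_cond big1 ?add0r //.
move=> i /andP[/andP[_ ltiN] _].
by rewrite cpow0 subn_eq0 leqNgt ltiN mulr0.
Qed.

(** The sum is the coefficient of x^N in F_0^p (1 + y F_0): the weight is 1 only at [i = N], where
    [cpow 0] alone survives, and [cpow 1] alone survives at every other index. *)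
Lemma cpow_conv_sorted p N :
  \sum_(0 <= i < N.+1) cpow p i * (cpow 0 (N - i) + cpow 1 (N - i)) *
      (if (i < N)%N then 'X else 1) =
  cpow p N + 'X * cpow p.+1 N.
Proof.
rewrite -[in RHS](cpow_conv0 p N) -(cpow_conv p N) mulr_sumr -big_split /=.
apply: eq_big_nat => i /andP[_]; rewrite ltnS leq_eqVlt => /predU1P[->|ltiN].
  by rewrite ltnn subnn !mulr0 !addr0 !mulr1.
by rewrite ltiN cpow0 subn_eq0 leqNgt ltiN /=; ring.
Qed.

(* [cpow 0] contributes only for the empty word, [cpow 1] only for the others. *)
Lemma des_gf_sorted w : sorted ltn w ->
  des_gf w = cpow 0 (size w) + cpow 1 (size w).
Proof.
have [n] := ubnP (size w); elim: n w => // n IHn w.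
case/lastP: w => [|v N] le_n srt; first by rewrite des_gf_nil addr0.
have [srt_v ltN] := sorted_rconsP srt.
rewrite des_gf_rcons ?(sorted_ltn_uniq srt_v) //.
rewrite size_rcons cpow0 add0r cpowSS.
rewrite size_rcons ltnS in le_n.
rewrite (eq_big_nat _ _ (F2 := fun i =>
    (cpow 0 i * (cpow 0 (size v - i) + cpow 1 (size v - i)) +
     cpow 1 i * (cpow 0 (size v - i) + cpow 1 (size v - i))) *
    (if (i < size v)%N then 'X else 1))) => [|i /andP[_ lt_i]]; last first.
  rewrite -mulrDl [des_gf (take i v)]IHn; first last.
  - by apply: take_sorted srt_v; apply: ltn_trans.
  - by rewrite size_take_min; lia.
  rewrite [des_gf (drop i v)]IHn ?drop_sorted //; last by rewrite size_drop; lia.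
  by rewrite size_drop size_takel.
under eq_bigr do rewrite mulrDl.
rewrite big_split /= !cpow_conv_sorted; ring.
Qed.

(** This is F_k = (x y)^k F_0^{k+1}. Arbitrary letters are allowed because removing the first letter
    or cutting off a suffix leaves the same shape with a shorter [b]; [k] varies because the former
    shortens the decreasing run. *)
Lemma des_gf_theta k a b : size a = k.+1 -> sorted ltn (a ++ b) ->
  des_gf (rev a ++ b) = 'X^k * cpow k.+1 (size b).+1.
Proof.
have [n] := ubnP (size b); elim: n k a b => // n IHn k a b.
rewrite ltnS => le_n sz_a srt.
case: k sz_a => [|k] sz_a.
  case: a sz_a srt => [|x [|y a]] //= _ srt.
  by rewrite des_gf_sorted // cpow0 add0r expr0 mul1r.
have uniq_ab := sorted_ltn_uniq srt.
case/lastP: a sz_a srt uniq_ab => // a z.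
rewrite size_rcons => -[sz_a] srt uniq_ab.
have lt_z x : x \in a -> (x < z)%N.
  by move: srt => /(cat_sorted2 (leT := ltn))[/sorted_rconsP[_ +] _]; apply.
have uniq_r : uniq (z :: rev a ++ b).
  rewrite -cat_cons -rev_rcons.
  by have /perm_uniq-> : perm_eq (rev (rcons a z) ++ b) (rcons a z ++ b)
    by rewrite perm_cat2r perm_rev.
(* Prefixes of the decreasing run with at least two letters end below their first letter [z];
   [i = k] is the whole run. *)
have dec0 i : (i < k.+1)%N -> des_gf (z :: take i.+1 (rev a)) = 0.
  move=> lt_i; have lt_ia : (i < size (rev a))%N by rewrite size_rev sz_a.
  have: uniq (z :: take i.+1 (rev a)).
    move: uniq_r; rewrite -cat_cons cat_uniq => /andP[+ _].
    by apply: subseq_uniq; rewrite /= eqxx take_subseq.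
  rewrite (take_nth 0%N lt_ia) -rcons_cons rcons_uniq => /andP[Ny uniq_t].
  apply: (@des_gf_not_max _ _ z) => //; first exact: mem_head.
  by rewrite lt_z // -mem_rev mem_nth.
rewrite rev_rcons cat_cons.
case/lastP: b le_n srt uniq_ab uniq_r => [|b N] le_n srt uniq_ab uniq_r.
  have := dec0 k (ltnSn k); rewrite cats0 take_oversize ?size_rev ?sz_a // => ->.
  by rewrite cpowSS !cpowS0 !mulr0 !addr0 mulr0.
move: srt; rewrite -rcons_cat => /sorted_rconsP[srt ltN].
have ltN' x : x \in z :: rev a ++ b -> (x < N)%N.
  move=> xr; apply: ltN; move: xr.
  by rewrite inE !mem_cat mem_rev mem_rcons inE orbA.
rewrite -rcons_cat -rcons_cons des_gf_rcons //; last first.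
  by move: uniq_r; rewrite -rcons_cat -rcons_cons rcons_uniq => /andP[].
have sz_v : size (z :: rev a ++ b) = (k.+2 + size b)%N.
  by rewrite /= size_cat size_rev sz_a.
(* Cuts are grouped as 0, 1, those strictly inside the run (from 2 to [k.+1], all zero), and those
   from [k.+2] on, whose left part contains the whole run. *)
rewrite sz_v big_ltn // big_ltn; last by rewrite !addSn.
rewrite (@big_cat_nat _ _ _ k.+2) //=; last by lia.
rewrite size_rcons in le_n.
rewrite (_ : \sum_(2 <= i < k.+2) _ = 0) ?add0r; last first.
  rewrite big_nat big1 // => -[|[|i]] // /andP[_ lt_i].
  have lt_ia : (i < size (rev a))%N by rewrite size_rev sz_a; lia.
  by rewrite /= takel_cat ?dec0 ?mul0r //; lia.
have gf1 : des_gf [:: z] = 1.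
  by rewrite des_gf_sorted //= cpowSS !cpow0 !cpowS0 !mulr0 !addr0 add0r.
have gf_v : des_gf (z :: rev a ++ b) = 'X^(k.+1) * cpow k.+2 (size b).+1.
  by rewrite -cat_cons -rev_rcons (IHn k.+1) // size_rcons sz_a.
have gf_v1 : des_gf (rev a ++ b) = 'X^k * cpow k.+1 (size b).+1.
  apply: IHn => //; apply: (subseq_sorted ltn_trans) srt.
  by rewrite cat_subseq // subseq_rcons.
rewrite take0 drop0 des_gf_nil gf1 gf_v gf_v1 !mul1r.
rewrite -[X in \sum_(X <= _ < _) _]add0n big_addn addnC -addSn addnK.
rewrite (eq_big_nat _ _ (F2 := fun j => 'X^(k.+1) * (cpow k.+2 j.+1 *
    (cpow 0 (size b - j) + cpow 1 (size b - j)) *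
    (if (j < size b)%N then 'X else 1)))); last first.
  move=> j /andP[_ lt_j]; rewrite addnS /= take_cat drop_cat.
  rewrite size_rev sz_a ltnNge leq_addl /= addnK.
  have [srt_az srt_b] := cat_sorted2 srt.
  rewrite -cat_cons -rev_rcons (IHn k.+1); last first.
  - move: srt; rewrite -{1}(cat_take_drop j b) catA.
    by case/(cat_sorted2 (leT := ltn)).
  - by rewrite size_rcons sz_a.
  - by rewrite size_take_min (leq_ltn_trans (geq_minr _ _)).
  rewrite des_gf_sorted ?drop_sorted // size_drop size_takel // !mulrA.
  by rewrite -addnS ltn_add2r.
rewrite -mulr_sumr.
(* The shifted sum is this convolution without its index 0, which contributes nothing since
   [cpow k.+2 0 = 0]. *)
have := cpow_conv_sorted k.+2 (size b).+1.
rewrite big_nat_recl // cpowS0 !mul0r add0r => ->.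
(* Up to the factor ['X^(k.+1)], cut 0 gives ['X * cpow k.+2], cut 1 gives [cpow k.+1], and the long
   cuts give [cpow k.+2 + 'X * cpow k.+3], all at [(size b).+1]: together, the recurrence. *)
rewrite size_rcons [in RHS]cpowSS exprS; ring.
Qed.

Lemma des_gf_coef w m :
  (des_gf w)`_m = (count (fun u => descents u == m) (preims w))%:R.
Proof.
rewrite /des_gf coef_sum -sum1_count natr_sum [RHS]big_mkcond /=.
by apply: eq_bigr => u _; rewrite coefXn eq_sym; case: eqP.
Qed.

Lemma des_gf_horner1 w : (des_gf w).[1] = (size (preims w))%:R.
Proof.
rewrite /des_gf horner_sum -sum1_size natr_sum.
by apply: eq_bigr => u _; rewrite hornerXn expr1n.
Qed.

End DescentSeries.

(** * Size and descent distribution of the fiber *)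

Theorem theorem7p2 (n k : nat) (hn : 1 <= n) (hk : k <= n - 1) :
  ((#|stack_sort_fiber n (theta n k)|%:R : rat)
     = (2 * k + 2)%N%:R / (n + 1)%N%:R * 'C(2 * n - 2 * k - 1, n)%:R)%R
  /\ (forall m : nat,
       (#|[set p in stack_sort_fiber n (theta n k) | descents (word p) == m]|%:R
          : rat)
         = narayana k (n - k) (m%:Z - k%:Z + 1))%R.
Proof.
have perm_theta := theta_perm (n := n) (k := k) ltac:(lia).
have gfE : des_gf (theta n k) = ('X^k * cpow k.+1 (n - k))%R.
  rewrite /theta (des_gf_theta (k := k)) ?size_iota -?iotaD ?iota_ltn_sorted //.
  by congr (_ * cpow _ _)%R; lia.
have nk_neq0 : ((n - k)%:R != 0 :> rat)%R by rewrite pnatr_eq0; lia.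
split.
  have -> : #|stack_sort_fiber n (theta n k)| = size (preims (theta n k)).
    rewrite -count_predT -(card_fiber predT perm_theta).
    by apply: eq_card => p; rewrite !inE andbT.
  rewrite -des_gf_horner1 gfE hornerM hornerXn expr1n mul1r.
  apply: (mulfI nk_neq0); rewrite cpow_horner1.
  have -> : (k.+1 + (n - k) = n.+1)%N by lia.
  have -> : ((n - k).*2 = (2 * n - 2 * k - 1).+1)%N by lia.
  have n1_neq0 : ((n + 1)%:R != 0 :> rat)%R by rewrite pnatr_eq0 addn1.
  apply: (mulfI n1_neq0).
  (* Absorption turns the binomial of [cpow_horner1] at [p = k.+1] into the stated one. *)
  have binE : (n.+1%:R * 'C((2 * n - 2 * k - 1).+1, n.+1)%:R =
      2 * (n - k)%:R * 'C(2 * n - 2 * k - 1, n)%:R :> rat)%R.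
    by rewrite -!natrM -mul_bin_diag; congr (_ * _)%:R%R; lia.
  have -> : (2 * k + 2)%N = (2 * k.+1)%N by lia.
  rewrite mulrCA addn1 binE natrM; field.
  by rewrite nat1r -addn1.
move=> m; rewrite (card_fiber (fun u => descents u == m) perm_theta).
rewrite -des_gf_coef gfE coefXnM /narayana.
(* For [m < k] the factor ['X^k] kills the coefficient, and the lower index m - k of the Narayana
   number is negative. Otherwise [cpow_coef] applies with [j = m - k]. *)
case: ltnP => [lt_mk|le_km].
  have -> : (m%:Z - k%:Z + 1 - 1 = Negz (k - m).-1)%R by rewrite NegzE; lia.
  by rewrite mulr0.
have -> : (m%:Z - k%:Z + 1 + k%:Z = m.+1)%R by lia.
have -> : (m%:Z - k%:Z + 1 - 1 = (m - k)%N)%R by lia.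
apply: (mulfI nk_neq0); rewrite cpow_coef /=.
have -> : (k.+1 + (m - k) = m.+1)%N by lia.
by field.
Qed.
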